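(* Let $N,j,k\in\mathbb{N}_0$ with $1\le j<k\le N+1$, and let $\mathbf{m}=\{n_1,\ldots,n_{N+1}\}$ be a list of degrees $n_i\in\mathbb{N}_0$. Let $(p_n(x;\boldsymbol\alpha))_{n\ge0}$ be a sequence of orthogonal polynomials with respect to a measure $\mu$ with support $\mathcal{I}$, satisfying $p_{n+1}(x;\boldsymbol\alpha)=(A_nx+B_n)p_n(x;\boldsymbol\alpha)-C_np_{n-1}(x;\boldsymbol\alpha)$ for $n\ge 0$, with $p_{-1}:=0$. Then the definite integral $$\mathsf{P}=\mathsf{P}(\mathbf{m};\boldsymbol\alpha):=\int_{\mathcal{I}}p_{n_1}(x;\boldsymbol\alpha)\cdots p_{n_{N+1}}(x;\boldsymbol\alpha)\,d\mu$$ satisfies, for each of the $\binom{N+1}{2}$ pairs $(j,k)$, the contiguous relation $$(B_{n_j}A_{n_k}-A_{n_j}B_{n_k})\mathsf{P}-A_{n_k}\mathsf{P}^{+}_{j}-C_{n_j}A_{n_k}\mathsf{P}^{-}_{j}+A_{n_j}\mathsf{P}^{+}_{k}+C_{n_k}A_{n_j}\mathsf{P}^{-}_{k}=0.$$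
   Context: $\mathbb{N}_0=\{0,1,2,\ldots\}$. The polynomials $p_n(x;\boldsymbol\alpha)$ ($\boldsymbol\alpha$ a set of parameters) satisfy $\int_{\mathcal I}p_m(x;\boldsymbol\alpha)p_n(x;\boldsymbol\alpha)\,d\mu=h_n(\boldsymbol\alpha)\delta_{m,n}$. The shifted integrals are $\mathsf{P}_j^{\pm}:=\mathsf{P}(n_1,\ldots,n_{j-1},n_j\pm1,n_{j+1},\ldots,n_{N+1};\boldsymbol\alpha)$, where an integral involving $p_{-1}$ is $0$. *)

(* Defs.v *)
From HB Require Import structures.
From mathcomp Require Import all_boot all_order all_algebra.
From mathcomp Require Import all_classical all_reals all_analysis.

Set Implicit Arguments.
Unset Strict Implicit.
Unset Printing Implicit Defensive.

Import Order.TTheory GRing.Theory Num.Theory.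
Import numFieldNormedType.Exports.

Local Open Scope classical_set_scope.
Local Open Scope ring_scope.

Definition msupport (R : realType)
    (mu : {measure set (measurableTypeR R) -> \bar R}) : set R :=
  [set x | forall U : set R, open U -> U x -> (0 < mu U)%E].

(* Degrees are integers so that [p_(-1) = 0] is a value of the sequence. *)
Definition extend_neg (R : realType) (p : nat -> {poly R}) (d : int) :
    {poly R} :=
  if d is Posz n then p n else 0.

(* Finiteness of the moments makes every integral of a polynomial meaningful;
   without it [Rintegral] may return a junk value. *)
Definition orthogonal_polynomials (R : realType)
    (mu : {measure set (measurableTypeR R) -> \bar R}) (I : set R)
    (p : nat -> {poly R}) (h : nat -> R) : Prop :=
  [/\ forall r : nat, mu.-integrable I (fun x : R => (x ^+ r)%:E),
      forall n : nat, size (p n) = n.+1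
    & forall m n : nat,
        \int[mu]_(x in I) ((p m).[x] * (p n).[x]) =
        if m == n then h n else 0].

Definition three_term_recurrence (R : realType) (p : nat -> {poly R})
    (A B C : nat -> R) : Prop :=
  forall n : nat,
    p n.+1 = (A n *: 'X + (B n)%:P) * p n
             - C n *: extend_neg p (n%:Z - 1).

Definition product_integral (R : realType)
    (mu : {measure set (measurableTypeR R) -> \bar R}) (I : set R)
    (p : nat -> {poly R}) (M : nat) (d : 'I_M -> int) : R :=
  \int[mu]_(x in I) (\prod_(i < M) (extend_neg p (d i)).[x]).

Definition shift_degree (M : nat) (j : 'I_M) (e : int) (d : 'I_M -> int) :
    'I_M -> int :=
  fun i => if i == j then d i + e else d i.

(* Main.v *)
(** Applying the recurrence to the [i]-th factor of the product gives
[P_i^+ = A_(n_i) Q + B_(n_i) P - C_(n_i) P_i^-], where [Q], the integral of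
[x] times the product, does not depend on [i].  Eliminating [Q] between the
relations for [i = j] and [i = k] gives the contiguous relation. *)

Require Import Defs.
From HB Require Import structures.
From mathcomp Require Import all_boot all_order all_algebra.
From mathcomp Require Import all_classical all_reals all_analysis.
From mathcomp Require Import measurable_realfun ring.

Set Implicit Arguments.
Unset Strict Implicit.
Unset Printing Implicit Defensive.

Import Order.TTheory GRing.Theory Num.Theory.
Import numFieldNormedType.Exports.

Local Open Scope classical_set_scope.
Local Open Scope ring_scope.

(** Serves to make the domain of integration measurable. An open neighbourhood of a limit point
    contains a support point, hence is a neighbourhood of that point too and has positive
    measure. *)
Lemma msupport_closed (R : realType)
    (mu : {measure set (measurableTypeR R) -> \bar R}) : closed (msupport mu).
Proof.
move=> x clx U oU Ux.
have [y [suppy Uy]] := clx U (open_nbhs_nbhs (conj oU Ux)).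
exact: suppy.
Qed.

Section PolynomialIntegral.
Variables (R : realType).
Variables (mu : {measure set (measurableTypeR R) -> \bar R}) (I : set R).
Hypothesis mI : measurable (I : set (measurableTypeR R)).
Hypothesis moments :
  forall r : nat, mu.-integrable I (fun x : R => (x ^+ r)%:E).

(** A polynomial is a finite linear combination of the monomials in [moments]. Integrability is what
    licenses the linearity rules for [Rintegral] below. *)
Lemma integrable_horner (q : {poly R}) :
  mu.-integrable I (EFin \o (fun x : measurableTypeR R => q.[x])).
Proof.
apply: (@eq_integrable _ _ _ mu I mI
  (fun x => \sum_(i < size q) (q`_i)%:E * (x ^+ i)%:E)%E).
  by move=> x _ /=; rewrite horner_coef -sumEFin.
by apply: integrable_sum => // i _; apply: integrableZl.
Qed.

Lemma Rintegral_hornerD (q r : {poly R}) :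
  \int[mu]_(x in I) (q + r).[x] =
  \int[mu]_(x in I) q.[x] + \int[mu]_(x in I) r.[x].
Proof.
rewrite -RintegralD //; try exact: integrable_horner.
by apply: eq_Rintegral => x _; rewrite hornerD.
Qed.

Lemma Rintegral_hornerZ (a : R) (q : {poly R}) :
  \int[mu]_(x in I) (a *: q).[x] = a * \int[mu]_(x in I) q.[x].
Proof.
rewrite -RintegralZl //; last exact: integrable_horner.
by apply: eq_Rintegral => x _; rewrite hornerZ.
Qed.

Variables (p : nat -> {poly R}) (A B C : nat -> R) (M : nat) (n : 'I_M -> nat).
Hypothesis rec : three_term_recurrence p A B C.

Let m : 'I_M -> int := fun i => (n i)%:Z.
Let prodp (d : 'I_M -> int) : {poly R} := \prod_(i < M) extend_neg p (d i).

Lemma product_integralE (d : 'I_M -> int) :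
  product_integral mu I p d = \int[mu]_(x in I) (prodp d).[x].
Proof. by apply: eq_Rintegral => x _; rewrite horner_prod. Qed.

(** The cofactor is free of [e], so the shifts by 1 and -1 share it. *)
Lemma prod_shift_degree (i : 'I_M) (e : int) :
  prodp (shift_degree i e m) =
  extend_neg p (m i + e) * \prod_(l < M | l != i) p (n l).
Proof.
rewrite /prodp (bigD1 i) //= /shift_degree eqxx; congr (_ * _).
by apply: eq_bigr => l /negPf ->.
Qed.

Lemma product_integral_recurrence (i : 'I_M) :
  product_integral mu I p (shift_degree i 1 m) =
  A (n i) * \int[mu]_(x in I) ('X * prodp m).[x]
  + B (n i) * product_integral mu I p m
  - C (n i) * product_integral mu I p (shift_degree i (-1) m).
Proof.
(* Linearity, read backwards, gathers the right side into one integral; [mulNr] first moves the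
   minus sign into the scalar. A polynomial identity between the integrands remains. *)
rewrite !product_integralE -mulNr -!Rintegral_hornerZ -!Rintegral_hornerD.
apply: eq_Rintegral => x _; congr (_.[x]).
(* Only the raised degree is computed, to expose [p (n i).+1] for [rec]. The lowered one stays under
   [extend_neg], as in the recurrence, so [n i = 0] needs no separate case. *)
rewrite !prod_shift_degree {1}/m -PoszD addn1 /= rec.
rewrite [prodp m](bigD1 i) //= -!mul_polyC polyCN.
by rewrite /m; ring.
Qed.

End PolynomialIntegral.

Theorem theorem3p1 (R : realType)
    (mu : {measure set (measurableTypeR R) -> \bar R}) (I : set R)
    (p : nat -> {poly R}) (h A B C : nat -> R)
    (N : nat) (n : 'I_N.+1 -> nat) (j k : 'I_N.+1) :
  I = msupport mu ->
  orthogonal_polynomials mu I p h ->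
  three_term_recurrence p A B C ->
  (j < k)%N ->
  let m : 'I_N.+1 -> int := fun i => (n i)%:Z in
  let P (d : 'I_N.+1 -> int) : R := product_integral mu I p d in
  (B (n j) * A (n k) - A (n j) * B (n k)) * P m
  - A (n k) * P (shift_degree j 1 m)
  - C (n j) * A (n k) * P (shift_degree j (-1) m)
  + A (n j) * P (shift_degree k 1 m)
  + C (n k) * A (n j) * P (shift_degree k (-1) m) = 0.
Proof.
move=> IE [moments _ _] rec _ m P.
have mI : measurable (I : set (measurableTypeR R)).
  rewrite IE; apply: closed_measurable; exact: msupport_closed.
(* Both raised integrals are replaced; the integral with the factor ['X] then occurs with
   coefficients [- A (n k) * A (n j)] and [A (n j) * A (n k)]. *)
rewrite /P !(product_integral_recurrence mI moments n rec).
by rewrite -/m; ring.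
Qed.
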